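(* Let $R$ be a real closed field equipped with an o-minimal structure expanding $R$, and let $f:X\to Y$ be a continuous definable map between definable sets $X$ and $Y$. Then $\widetilde f:\widetilde X\to\widetilde Y$, $\widetilde f(\gamma)=f\circ\gamma$, is continuous.
   Context: An o-minimal structure expanding a real closed field $R$ is a collection of Boolean algebras $\mathcal S^n$ of subsets of $R^n$ ($n\in\mathbb N$) containing all algebraic subsets, closed under Cartesian products and coordinate projections $R^{n+1}\to R^n$, such that elements of $\mathcal S^1$ are finite unions of points and open intervals. Members are called definable sets; a function is definable if its graph is. For a definable set $X\subset R^n$, $\widetilde X$ denotes the set of germs at $0\in R$ of continuous definable functions from $(0,\infty)$ to $X$ (i.e. continuous definable maps $(0,\epsilon)\to X$, $\epsilon>0$ in $R$, two being identified when they agree on some $(0,\epsilon')$). $\widetilde R$ is a real closed field under pointwise operations, in which $\gamma\ge0$ iff $\gamma(t)\ge 0$ for all small $t>0$. $\widetilde{R}^n$ carries its Euclidean topology, with basis the open balls $\{\delta:|\delta-\gamma|<r\}$, $r\in\widetilde R$, $r>0$, where $|x|=\sqrt{x_1^2+\dots+x_n^2}$; $\widetilde X\subset\widetilde R^n$ carries the induced topology. For a definable map $f:X\to Y$, $\widetilde f:\widetilde X\to\widetilde Y$ is defined by $\widetilde f(\gamma)=f\circ\gamma$ (as a germ at $0$). *)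

(* Defs.v *)
From HB Require Import structures.
From mathcomp Require Import all_boot all_order all_algebra generic_quotient.
From mathcomp Require Import boolp classical_sets functions topology normedtype.
(* mpoly's notations cannot be loaded together with mathcomp-analysis:
   {mpoly R[n]} is written mpoly n R, and p.@[v] is written meval v p. *)
From mathcomp Require Import -(notations) mpoly.
From mathcomp Require Import ring lra.
Set Implicit Arguments.
Unset Strict Implicit.
Unset Printing Implicit Defensive.
Import Order.TTheory GRing.Theory Num.Theory numFieldNormedType.Exports.
Local Open Scope classical_set_scope.
Local Open Scope ring_scope.
Local Open Scope quotient_scope.

Variant point_or_open_itv (R : rcfType) : set R -> Prop :=
| Point (a : R) : point_or_open_itv [set a]
| OpenItv (a b : R) : point_or_open_itv `]a, b[
| OpenItvNy (b : R) : point_or_open_itv `]-oo, b[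
| OpenItvy (a : R) : point_or_open_itv `]a, +oo[
| OpenItvNyy : point_or_open_itv `]-oo, +oo[.

Record ominimal (R : rcfType) := OMinimal {
  definable : forall n, set (set 'rV[R]_n) ;
  definableU : forall n (A B : set 'rV[R]_n),
    definable A -> definable B -> definable (A `|` B) ;
  definableC : forall n (A : set 'rV[R]_n), definable A -> definable (~` A) ;
  definable_algebraic : forall n (ps : seq (mpoly n R)),
    definable [set x : 'rV[R]_n | all (fun p => meval (x 0) p == 0) ps] ;
  definableX : forall n m (A : set 'rV[R]_n) (B : set 'rV[R]_m),
    definable A -> definable B ->
    definable [set row_mx x y | x in A & y in B] ;
  definable_proj : forall n (i : 'I_n.+1) (A : set 'rV[R]_n.+1),
    definable A -> definable [set (col' i x : 'rV[R]_n) | x in A] ;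
  definable1 : forall A : set 'rV[R]_1, definable A ->
    exists (k : nat) (B : 'I_k -> set R),
      (forall i, point_or_open_itv (B i)) /\
      [set x 0 0 | x in A] = \bigcup_i B i }.

(* f is a total function that only matters on D: this is definability of the
   graph of f : D -> R^m. *)
Definition definable_fun (R : rcfType) (S : ominimal R) (n m : nat)
    (D : set 'rV[R]_n) (f : 'rV[R]_n -> 'rV[R]_m) :=
  definable S [set row_mx x (f x) | x in D].

Section definability.
Context {R : rcfType} (S : ominimal R).

Lemma definable_ext n (A B : set 'rV[R]_n) :
  definable S A -> (forall x, A x <-> B x) -> definable S B.
Proof. by move=> dA AB; rewrite (_ : B = A) //; apply/seteqP; split=> x /AB. Qed.

Lemma definableI n (A B : set 'rV[R]_n) :
  definable S A -> definable S B -> definable S (A `&` B).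
Proof.
move=> dA dB; rewrite -[A `&` B]setCK setCI.
by apply: definableC; apply: definableU; apply: definableC.
Qed.

Lemma definableT n : definable S (@setT 'rV[R]_n).
Proof. exact: definable_ext (definable_algebraic S [::]) _. Qed.

Definition polyfun n (f : 'rV[R]_n -> R) :=
  exists p : mpoly n R, forall x, f x = meval (x 0) p.

Lemma polyfun_coord n (i : 'I_n) : polyfun (fun x => x 0 i).
Proof. by exists (mpolyX _ (mnm1 i)) => x; rewrite mevalXU. Qed.

Lemma polyfun_cst n c : polyfun (fun _ : 'rV[R]_n => c).
Proof. by exists (mpolyC _ c) => x; rewrite mevalC. Qed.

Lemma polyfunD n (f g : 'rV[R]_n -> R) :
  polyfun f -> polyfun g -> polyfun (fun x => f x + g x).
Proof. by case=> p fp [q gq]; exists (p + q) => x; rewrite mevalD fp gq. Qed.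

Lemma polyfunN n (f : 'rV[R]_n -> R) : polyfun f -> polyfun (fun x => - f x).
Proof. by case=> p fp; exists (- p) => x; rewrite mevalN fp. Qed.

Lemma polyfunM n (f g : 'rV[R]_n -> R) :
  polyfun f -> polyfun g -> polyfun (fun x => f x * g x).
Proof. by case=> p fp [q gq]; exists (p * q) => x; rewrite mevalM fp gq. Qed.

Lemma definable_eq n (f g : 'rV[R]_n -> R) :
  polyfun f -> polyfun g -> definable S [set x | f x = g x].
Proof.
move=> pf pg; have [p fgp] := polyfunD pf (polyfunN pg).
apply: definable_ext (definable_algebraic S [:: p]) _ => x /=.
by rewrite andbT -fgp subr_eq0; split=> [/eqP|->].
Qed.

Lemma definable_bigI n (I : finType) (A : I -> set 'rV[R]_n) :
  (forall i, definable S (A i)) -> definable S [set x | forall i, A i x].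
Proof.
move=> dA.
suff H (s : seq I) : definable S [set x | forall i, i \in s -> A i x].
  apply: definable_ext (H (enum I)) _ => x /=; split=> + i => /(_ i) //.
  by rewrite mem_enum => /(_ isT).
elim: s => [|i s IHs]; first by apply: definable_ext (definableT n) _ => x.
apply: definable_ext (definableI (dA i) IHs) _ => x /=; split.
  by case=> Ai As j; rewrite inE => /orP[/eqP->//|]; apply: As.
by move=> H; split=> [|j js]; apply: H; rewrite inE ?eqxx ?js ?orbT.
Qed.

Lemma definable_ex_mx k n (A : set 'rV[R]_(k + n)) :
  definable S A -> definable S [set x | exists2 z, A z & rsubmx z = x].
Proof.
elim: k A => [|k IHk] A dA.
  apply: definable_ext dA _ => x /=; split=> [Ax|[z Az <-]].
    by exists x => //; apply/rowP => j; rewrite mxE; congr (x _ _); apply: val_inj.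
  by rewrite (_ : rsubmx z = z) //; apply/rowP => j; rewrite mxE;
    congr (z _ _); apply: val_inj.
apply: definable_ext (IHk _ (definable_proj ord0 dA)) _ => x /=; split.
  case=> z' [z Az <-] <-; exists z => //; apply/rowP => j.
  by rewrite !mxE; congr (z _ _); apply: val_inj.
case=> z Az <-; exists (col' ord0 z); first by exists z.
by apply/rowP => j; rewrite !mxE; congr (z _ _); apply: val_inj.
Qed.

Lemma definable_ex k n (A : set 'rV[R]_(k + n)) :
  definable S A -> definable S [set x | exists y : 'rV[R]_k, A (row_mx y x)].
Proof.
move=> /definable_ex_mx dA; apply: definable_ext dA _ => x /=; split.
  by case=> z Az <-; exists (lsubmx z); rewrite hsubmxK.
by case=> y Ay; exists (row_mx y x); rewrite ?row_mxKr.
Qed.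

Definition coordmap n m (g : 'rV[R]_n -> 'rV[R]_m) :=
  exists s : 'I_m -> 'I_n, forall x i, g x 0 i = x 0 (s i).

Lemma coordmap_id n : coordmap (fun x : 'rV[R]_n => x).
Proof. by exists id. Qed.

Lemma coordmap_lsub n m k (g : 'rV[R]_n -> 'rV[R]_(m + k)) :
  coordmap g -> coordmap (fun x => lsubmx (g x)).
Proof. by case=> s gs; exists (fun i => s (lshift _ i)) => x i; rewrite mxE. Qed.

Lemma coordmap_rsub n m k (g : 'rV[R]_n -> 'rV[R]_(m + k)) :
  coordmap g -> coordmap (fun x => rsubmx (g x)).
Proof. by case=> s gs; exists (fun i => s (rshift _ i)) => x i; rewrite mxE. Qed.

Lemma coordmap_row n m k (g : 'rV[R]_n -> 'rV[R]_m) (h : 'rV[R]_n -> 'rV[R]_k) :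
  coordmap g -> coordmap h -> coordmap (fun x => row_mx (g x) (h x)).
Proof.
case=> s gs [t ht].
exists (fun i : 'I_(m + k) => match fintype.split i with inl a => s a | inr a => t a end) => x i.
by rewrite mxE; case: fintype.splitP => a _.
Qed.

Lemma definable_preimage n m (g : 'rV[R]_n -> 'rV[R]_m) (A : set 'rV[R]_m) :
  coordmap g -> definable S A -> definable S [set x | A (g x)].
Proof.
case=> s gs dA.
have dE : definable S
    [set z : 'rV[R]_(m + n) | forall i, lsubmx z 0 i = rsubmx z 0 (s i)].
  apply: definable_bigI => i; apply: definable_eq.
    have [p pE] := polyfun_coord (lshift n i).
    by exists p => x; rewrite mxE -pE.
  have [p pE] := polyfun_coord (rshift m (s i)).
  by exists p => x; rewrite mxE -pE.
apply: (definable_ext (definable_ex (definableI (definableX dA (@definableT n)) dE))) => x; split=> /=.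
  case=> y [[a Aa [b _ /eq_row_mx[ay _]]]].
  subst a; rewrite row_mxKl row_mxKr => yE.
  by rewrite (_ : g x = y) //; apply/rowP => i; rewrite gs yE.
move=> Agx; exists (g x); split; first by exists (g x) => //; exists x.
by rewrite row_mxKl row_mxKr => i; exact: gs.
Qed.

Lemma definable_gt0 n (f : 'rV[R]_n -> R) :
  polyfun f -> definable S [set x | 0 < f x].
Proof.
move=> [p fp].
(* 0 < f x iff f x * y ^ 2 = 1 for some y *)
pose g := fun z : 'rV[R]_(1 + n) => f (rsubmx z) * (lsubmx z 0 0 * lsubmx z 0 0).
have pl : polyfun (fun z : 'rV[R]_(1 + n) => lsubmx z 0 0).
  by have [q qE] := polyfun_coord (@lshift 1 n 0); exists q => x; rewrite mxE -qE.
have pr : polyfun (fun z : 'rV[R]_(1 + n) => f (rsubmx z)).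
  exists (comp_mpoly [tuple mpolyX R (mnm1 (rshift 1 i)) | i < n] p) => z.
  rewrite fp comp_mpoly_meval; apply: meval_eq => i.
  by rewrite tnth_mktuple mevalXU mxE.
have pg : polyfun g by apply: polyfunM => //; apply: polyfunM.
apply: (definable_ext (definable_ex (definable_eq pg (polyfun_cst _ 1)))) => x /=; rewrite /g; split.
  case=> y; rewrite row_mxKl row_mxKr -expr2 => fy.
  rewrite ltNge; apply/negP => fx0.
  have : f x * y 0 0 ^+ 2 <= 0 by rewrite mulr_le0_ge0 ?sqr_ge0.
  by rewrite fy ler10.
move=> fx0; exists (const_mx (Num.sqrt (f x)^-1)).
rewrite row_mxKl row_mxKr !mxE -expr2 sqr_sqrtr ?invr_ge0 ?ltW // mulfV //.
exact: lt0r_neq0.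
Qed.

Lemma definable_ge0 n (f : 'rV[R]_n -> R) :
  polyfun f -> definable S [set x | 0 <= f x].
Proof.
move=> pf; apply: definable_ext (definableC (definable_gt0 (polyfunN pf))) _.
by move=> x /=; rewrite oppr_gt0 leNgt; split=> /negP.
Qed.

Lemma definable_graph n m (D : set 'rV[R]_n) (f : 'rV[R]_n -> 'rV[R]_m) :
  definable_fun S D f <->
  definable S [set z | D (lsubmx z) /\ rsubmx z = f (lsubmx z)].
Proof.
rewrite /definable_fun; split=> df; apply: (definable_ext df) => z /=; split.
- by case=> x Dx <-; rewrite row_mxKl row_mxKr.
- by case=> Dz zf; exists (lsubmx z) => //; rewrite -zf hsubmxK.
- by case=> Dz zf; exists (lsubmx z) => //; rewrite -zf hsubmxK.
- by case=> x Dx <-; rewrite row_mxKl row_mxKr.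
Qed.

Lemma definable_fun_comp n m k (D : set 'rV[R]_n) (E : set 'rV[R]_m)
    (g : 'rV[R]_n -> 'rV[R]_m) (f : 'rV[R]_m -> 'rV[R]_k) :
  (forall x, D x -> E (g x)) -> definable_fun S D g -> definable_fun S E f ->
  definable_fun S D (fun x => f (g x)).
Proof.
move=> DE /definable_graph dg /definable_graph df; apply/definable_graph.
pose c := fun w : 'rV[R]_(m + (n + k)) => row_mx (lsubmx (rsubmx w)) (lsubmx w).
pose d := fun w : 'rV[R]_(m + (n + k)) => row_mx (lsubmx w) (rsubmx (rsubmx w)).
have cc : coordmap c.
  by apply: coordmap_row; do ?[apply: coordmap_lsub|apply: coordmap_rsub];
    exact: coordmap_id.
have cd : coordmap d.
  by apply: coordmap_row; do ?[apply: coordmap_lsub|apply: coordmap_rsub];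
    exact: coordmap_id.
apply: (definable_ext (definable_ex (definableI (definable_preimage cc dg)
                                 (definable_preimage cd df)))) => z; rewrite /c /d /=; split.
  by case=> y; rewrite !row_mxKl !row_mxKr => -[[Dz ->] [_ ->]].
case=> Dz zE; exists (g (lsubmx z)); rewrite !row_mxKl !row_mxKr.
by split; split=> //; exact: DE.
Qed.

Lemma definable_fun_row n m k (D : set 'rV[R]_n)
    (g : 'rV[R]_n -> 'rV[R]_m) (f : 'rV[R]_n -> 'rV[R]_k) :
  definable_fun S D g -> definable_fun S D f ->
  definable_fun S D (fun x => row_mx (g x) (f x)).
Proof.
move=> /definable_graph dg /definable_graph df; apply/definable_graph.
pose c := fun w : 'rV[R]_(n + (m + k)) => row_mx (lsubmx w) (lsubmx (rsubmx w)).
pose d := fun w : 'rV[R]_(n + (m + k)) => row_mx (lsubmx w) (rsubmx (rsubmx w)).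
have cc : coordmap c.
  by apply: coordmap_row; do ?[apply: coordmap_lsub|apply: coordmap_rsub];
    exact: coordmap_id.
have cd : coordmap d.
  by apply: coordmap_row; do ?[apply: coordmap_lsub|apply: coordmap_rsub];
    exact: coordmap_id.
apply: (definable_ext (definableI (definable_preimage cc dg) (definable_preimage cd df))) => z; rewrite /c /d /= !row_mxKl !row_mxKr; split.
  by case=> -[Dz zl] [_ zr]; split=> //; rewrite -zl -zr hsubmxK.
by case=> Dz zE; rewrite zE row_mxKl row_mxKr.
Qed.

Lemma definable_fun_sub n m (D E : set 'rV[R]_n) (f : 'rV[R]_n -> 'rV[R]_m) :
  definable S E -> E `<=` D -> definable_fun S D f -> definable_fun S E f.
Proof.
move=> dE ED /definable_graph df; apply/definable_graph.
apply: (definable_ext (definableI (definable_preimage (coordmap_lsub (@coordmap_id (n + m))) dE) df)) => z /=; split=> [[? []]//|[Ez zE]].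
by split=> //; split=> //; exact: ED.
Qed.

End definability.


(* g represents a germ at 0 of a continuous definable function (0, oo) -> X:
   only its values on some ]0, e[ matter. *)
Definition is_curve (R : rcfType) (S : ominimal R) (n : nat)
    (X : set 'rV[R]_n) (g : R -> 'rV[R]_n) :=
  exists2 e : R, 0 < e &
    [/\ set_fun `]0, e[ X g,
        definable_fun S [set t : 'rV[R]_1 | t 0 0 \in `]0, e[] (fun t => g (t 0 0))
      & {within `]0, e[, continuous g}].

Section curves.
Context {R : rcfType} (S : ominimal R).

Lemma near0 (e : R) : 0 < e -> \forall t \near 0^'+, t \in `]0, e[.
Proof.
move=> e0; apply: filterS2 (nbhs_right_gt 0) (nbhs_right_lt e0) => t t0 te.
by rewrite in_itv /= t0.
Qed.

Lemma mx_cvg (T : Type) (F : set_system T) n (f : T -> 'rV[R]_n) (l : 'rV[R]_n) :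
  Filter F -> (forall j, (fun t => f t 0 j) @ F --> l 0 j) -> f @ F --> l.
Proof.
move=> FF fl A [P lP PA]; rewrite nbhs_simpl /=.
have : \forall t \near F, forall j, P 0 j (f t 0 j).
  by apply: filter_forall => j; apply: fl; apply: lP.
by apply: filterS => t Pt; apply: PA => i j; rewrite (ord1 i).
Qed.

Lemma mx_cvg_coord (T : Type) (F : set_system T) n (f : T -> 'rV[R]_n)
    (l : 'rV[R]_n) j :
  Filter F -> f @ F --> l -> (fun t => f t 0 j) @ F --> l 0 j.
Proof.
move=> FF fl; have c := @coord_continuous R 1 n 0 j l.
exact: (cvg_comp f (fun M : 'rV[R]_n => M 0 j) fl c).
Qed.

Lemma curve_continuousP n (e : R) (g : R -> 'rV[R]_n) :
  {within `]0, e[, continuous g} <-> {in `]0, e[, continuous g}.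
Proof.
rewrite continuous_open_subspace; last exact: interval_open.
by split=> H t; [move=> te; apply: H; rewrite inE|rewrite inE; exact: H].
Qed.

Lemma definable_itv (e : R) :
  definable S [set t : 'rV[R]_1 | t 0 0 \in `]0, e[].
Proof.
have p0 := polyfun_coord (0 : 'I_1).
have := definableI (definable_gt0 S (p0 R))
  (definable_gt0 S (polyfunD (polyfun_cst 1 e) (polyfunN (p0 R)))).
move=> d; apply: (definable_ext d) => t /=.
by rewrite in_itv /= subr_gt0; split=> [[-> ->]|/andP].
Qed.

Lemma is_curve_shrink n (X : set 'rV[R]_n) (g : R -> 'rV[R]_n) (e e' : R) :
  e' <= e -> 
  [/\ set_fun `]0, e[ X g,
      definable_fun S [set t : 'rV[R]_1 | t 0 0 \in `]0, e[] (fun t => g (t 0 0))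
    & {within `]0, e[, continuous g}] ->
  [/\ set_fun `]0, e'[ X g,
      definable_fun S [set t : 'rV[R]_1 | t 0 0 \in `]0, e'[] (fun t => g (t 0 0))
    & {within `]0, e'[, continuous g}].
Proof.
move=> ee' [gX gd /curve_continuousP gc].
have sub t : t \in `]0, e'[ -> t \in `]0, e[.
  by rewrite !in_itv /= => /andP[-> /lt_le_trans->].
split=> [t /= /sub/gX//||].
- by apply: definable_fun_sub gd; [exact: definable_itv|move=> t; exact: sub].
- by apply/curve_continuousP => t /sub/gc.
Qed.

Lemma is_curve_comp n m (X : set 'rV[R]_n) (Y : set 'rV[R]_m)
    (f : 'rV[R]_n -> 'rV[R]_m) (g : R -> 'rV[R]_n) :
  set_fun X Y f -> definable_fun S X f -> {within X, continuous f} ->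
  is_curve S X g -> is_curve S Y (f \o g).
Proof.
move=> fXY fd /subspace_continuousP fc [e e0 [gX gd /curve_continuousP gc]].
exists e => //; split.
- by move=> t /gX/fXY.
- have := definable_fun_comp (E := X) _ gd fd; apply => t; exact: gX.
- apply/curve_continuousP => t te A fA.
  have /= := gc t te _ (fc _ (gX _ te) _ fA); rewrite !nbhs_simpl /= => H.
  have : \forall s \near t, s \in `]0, e[.
    exact: near_in_itvoo.
  by move: H; apply: filterS2 => s /= Xs /gX; exact: Xs.
Qed.

Lemma is_curve_row n m (X : set 'rV[R]_n) (Y : set 'rV[R]_m)
    (g : R -> 'rV[R]_n) (h : R -> 'rV[R]_m) :
  is_curve S X g -> is_curve S Y h ->
  is_curve S [set: 'rV[R]_(n + m)] (fun t => row_mx (g t) (h t)).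
Proof.
move=> [e e0 ge] [d d0 hd]; exists (Num.min e d); first by rewrite lt_min e0.
have lee : Num.min e d <= e by rewrite ge_min lexx.
have led : Num.min e d <= d by rewrite ge_min lexx orbT.
have [_ gdef /curve_continuousP gc] :=
  is_curve_shrink (e' := Num.min e d) lee ge.
have [_ hdef /curve_continuousP hc] :=
  is_curve_shrink (e' := Num.min e d) led hd.
split=> //; first exact: definable_fun_row.
apply/curve_continuousP => t te; apply: mx_cvg => j.
under eq_fun do rewrite mxE.
by rewrite mxE; case: fintype.splitP => k _; apply: mx_cvg_coord; [exact: gc|exact: hc].
Qed.

Lemma is_curve_sub n (X Y : set 'rV[R]_n) (g : R -> 'rV[R]_n) :
  X `<=` Y -> is_curve S X g -> is_curve S Y g.
Proof. by move=> XY [e e0 [gX ? ?]]; exists e => //; split=> // t /gX/XY. Qed.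

Lemma definable_dichotomy (A : set 'rV[R]_1) : definable S A ->
  (\forall t \near (0 : R)^'+, A t%:M) \/ (\forall t \near (0 : R)^'+, ~ A t%:M).
Proof.
move=> /definable1[k [B [Bp AB]]].
have AE t : A t%:M <-> exists i, B i t.
  have -> : A t%:M <-> [set x 0 0 | x in A] t.
    split=> [At|[x Ax <-]]; first by exists t%:M => //; rewrite mxE.
    rewrite (_ : (x 0 0)%:M = x) //; apply/rowP => j.
    by rewrite !ord1 mxE.
  by rewrite AB; split=> [[i _]|[i]]; exists i.
have Bd i : (\forall t \near (0 : R)^'+, B i t) \/
    (\forall t \near (0 : R)^'+, ~ B i t).
  have pos := nbhs_right_gt (0 : R).
  have main (a : R) : (\forall t \near (0 : R)^'+, t < a) \/
      (\forall t \near (0 : R)^'+, a < t).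
    case: (ltP 0 a) => a0; first by left; exact: nbhs_right_lt.
    by right; apply: filterS pos => t; exact: le_lt_trans.
  case: (Bp i) => [a|a b|b|a|].
  - right; case: (main a); apply: filterS => t /= + ta.
      by rewrite ta ltxx.
    by rewrite ta ltxx.
  - case: (main a) => [H|H].
      by right; apply: filterS H => t; rewrite /= in_itv /= ltNge => /negP ta /andP[/ltW].
    case: (main b) => [H'|H'].
      by left; apply: filterS2 H H' => t; rewrite /= in_itv /= => -> ->.
    by right; apply: filterS H' => t; rewrite /= in_itv /= => /ltW; rewrite leNgt => /negP tb /andP[_ /tb].
  - case: (main b) => [H'|H'].
      by left; apply: filterS H' => t; rewrite /= in_itv /=.
    by right; apply: filterS H' => t; rewrite /= in_itv /= => /ltW; rewrite leNgt => /negP.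
  - case: (main a) => [H'|H'].
      by right; apply: filterS H' => t; rewrite /= in_itv /= andbT => /ltW; rewrite leNgt => /negP.
    by left; apply: filterS H' => t; rewrite /= in_itv /= => ->.
  - by left; apply: filterE => t; rewrite /= in_itv.
have [[i Bi]|nB] := pselect (exists i, \forall t \near (0 : R)^'+, B i t).
  by left; apply: filterS Bi => t Bt; apply/AE; exists i.
right; have : \forall t \near (0 : R)^'+, forall i, ~ B i t.
  apply: filter_forall => i; case: (Bd i) => // Bi.
  by exfalso; apply: nB; exists i.
by apply: filterS => t Bt /AE[i /Bt].
Qed.

Lemma curve_dichotomy n (X P : set 'rV[R]_n) (g : R -> 'rV[R]_n) :
  is_curve S X g -> definable S P ->
  (\forall t \near (0 : R)^'+, P (g t)) \/ (\forall t \near (0 : R)^'+, ~ P (g t)).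
Proof.
move=> [e e0 [_ /definable_graph gd _]] dP.
have cr : coordmap (fun z : 'rV[R]_(n + 1) => lsubmx z).
  by apply: coordmap_lsub; exact: coordmap_id.
have cs : coordmap (fun z : 'rV[R]_(n + 1) => row_mx (rsubmx z) (lsubmx z)).
  apply: coordmap_row; [exact/coordmap_rsub/coordmap_id|exact: cr].
have := definable_ex (definableI (definable_preimage cr dP)
  (definable_preimage cs gd)).
set A := [set t | _] => dA.
have AE t : t \in `]0, e[ -> A t%:M <-> P (g t).
  move=> te; rewrite /A /=; split.
    by case=> y; rewrite !row_mxKl !row_mxKr mxE => -[Py [_ yE]]; rewrite -yE.
  by move=> Pg; exists (g t); rewrite !row_mxKl !row_mxKr mxE.
case: (definable_dichotomy dA) => H; [left|right].
  by apply: filterS2 (near0 e0) H => t te; move/AE; exact.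
by apply: filterS2 (near0 e0) H => t te nA /AE Pg; apply: nA; exact: Pg.
Qed.

End curves.

Record curve (R : rcfType) (S : ominimal R) (n : nat) (X : set 'rV[R]_n) :=
  Curve { curve_fun :> R -> 'rV[R]_n ; curveP : is_curve S X curve_fun }.

Section germs.
Context {R : rcfType} (S : ominimal R) (n : nat) (X : set 'rV[R]_n).

HB.instance Definition _ := gen_eqMixin (curve S X).
HB.instance Definition _ := gen_choiceMixin (curve S X).

Definition germ_eq (g h : curve S X) : bool :=
  `[< \forall t \near 0^'+, g t = h t >].

Lemma germ_eq_refl : reflexive germ_eq.
Proof. by move=> g; apply/asboolP; exact: filterE. Qed.

Lemma germ_eq_sym : ssrbool.symmetric germ_eq.
Proof.
by move=> g h; apply/asboolP/asboolP; apply: filterS => t ->.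
Qed.

Lemma germ_eq_trans : transitive germ_eq.
Proof.
move=> h g k /asboolP gh /asboolP hk; apply/asboolP.
by apply: filterS2 gh hk => t -> ->.
Qed.

Canonical germ_equiv := EquivRel germ_eq germ_eq_refl germ_eq_sym germ_eq_trans.

Definition tilde := {eq_quot germ_equiv}.

HB.instance Definition _ := Choice.on tilde.
HB.instance Definition _ := EqQuotient.on tilde.

Lemma eq_germ (g h : curve S X) :
  \pi_tilde g = \pi_tilde h <-> \forall t \near 0^'+, g t = h t.
Proof.
split=> [/eqP|H]; first by rewrite eqmodE => /asboolP.
by apply/eqP; rewrite eqmodE; apply/asboolP.
Qed.

Lemma repr_germ (g : curve S X) :
  \forall t \near 0^'+, repr (\pi_tilde g) t = g t.
Proof. by apply/eq_germ; rewrite reprK. Qed.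

End germs.

Section tilde_map.
Context {R : rcfType} (S : ominimal R) (n m : nat).
Variables (X : set 'rV[R]_n) (Y : set 'rV[R]_m) (f : 'rV[R]_n -> 'rV[R]_m).
Hypotheses (fXY : set_fun X Y f) (f_def : definable_fun S X f)
  (f_cont : {within X, continuous f}).

Definition curve_map (g : curve S X) : curve S Y :=
  Curve (is_curve_comp fXY f_def f_cont (curveP g)).

(* \widetilde f; well-definedness on germs is tilde_mapE. *)
Definition tilde_map (x : tilde S X) : tilde S Y :=
  \pi_(tilde S Y) (curve_map (repr x)).

Lemma tilde_mapE (g : curve S X) :
  tilde_map (\pi_(tilde S X) g) = \pi_(tilde S Y) (curve_map g).
Proof.
apply/eq_germ; apply: filterS (repr_germ g) => t /= ->.
by [].
Qed.

End tilde_map.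


Section scalar_curves.
Context {R : rcfType} (S : ominimal R).

Lemma near0P (P : set R) :
  (\forall t \near 0^'+, P t) -> exists2 e : R, 0 < e & forall t, t \in `]0, e[ -> P t.
Proof.
move=> [e /= e0 eP]; exists e => // t; rewrite in_itv /= => /andP[t0 te].
by apply: eP => //=; rewrite sub0r normrN gtr0_norm.
Qed.

Lemma is_curve_near n (X Y : set 'rV[R]_n) (g : R -> 'rV[R]_n) :
  is_curve S X g -> (\forall t \near 0^'+, Y (g t)) -> is_curve S Y g.
Proof.
move=> [e e0 ge] /near0P[d d0 gY]; exists (Num.min e d); first by rewrite lt_min e0.
have lee : Num.min e d <= e by rewrite ge_min lexx.
have [_ gd gc] := is_curve_shrink lee ge; split=> // t te; apply: gY.
by move: te; rewrite /= !in_itv /= lt_min => /and3P[-> _ ->].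
Qed.

Lemma is_curve_eq n (X : set 'rV[R]_n) (g h : R -> 'rV[R]_n) :
  is_curve S X g -> (\forall t \near 0^'+, g t = h t) -> is_curve S X h.
Proof.
move=> [e e0 ge] /near0P[d d0 gh]; pose c := Num.min e d.
exists c; first by rewrite lt_min e0.
have lec : c <= e by rewrite ge_min lexx.
have {}gh t : t \in `]0, c[ -> g t = h t.
  by rewrite !in_itv /= lt_min => /and3P[t0 _ td]; apply: gh; rewrite in_itv /= t0.
have [gX gd /curve_continuousP gc] := is_curve_shrink lec ge; split.
- by move=> t tc; rewrite -gh //; apply: gX.
- apply: (definable_ext gd) => z; split=> -[t tc <-]; exists t => //.
    by rewrite gh.
  by rewrite gh.
- apply/curve_continuousP => t tc; rewrite /continuous_at -gh //.
  apply: cvg_trans (gc t tc); apply: near_eq_cvg.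
  by apply: filterS (near_in_itvoo tc) => s sc; rewrite gh.
Qed.

Definition is_scurve (g : R -> R) := is_curve S [set: 'rV[R]_1] (fun t => (g t)%:M).

Lemma is_scurve_eq (g h : R -> R) : g =1 h -> is_scurve g -> is_scurve h.
Proof. by move=> /funext ->. Qed.

Lemma eq_scalar11 (x : 'rV[R]_1) a : x = a%:M <-> x 0 0 = a.
Proof.
split=> [->|<-]; first by rewrite mxE.
by apply/rowP => j; rewrite !ord1 mxE.
Qed.

Lemma is_scurve_fun n (X : set 'rV[R]_n) (p : 'rV[R]_n -> R) (g : R -> 'rV[R]_n) :
  definable S [set z : 'rV[R]_(n + 1) | X (lsubmx z) /\ rsubmx z 0 0 = p (lsubmx z)] ->
  (forall x, X x -> p @ within X (nbhs x) --> p x) ->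
  is_curve S X g -> is_scurve (p \o g).
Proof.
move=> pd pc gX.
suff : is_curve S [set: 'rV[R]_1] ((fun x => (p x)%:M) \o g) by [].
apply: is_curve_comp gX => //.
  apply/definable_graph; apply: (definable_ext pd) => z /=.
  by split=> -[Xz]; [move=> zp|move/eq_scalar11=> zp]; split=> //; apply/eq_scalar11.
apply/subspace_continuousP => x Xx; apply: mx_cvg => j.
by rewrite ord1 mxE; under eq_fun do rewrite mxE; exact: pc.
Qed.

Lemma poly_lsub n m (i : 'I_n) : polyfun (fun z : 'rV[R]_(n + m) => lsubmx z 0 i).
Proof. by have [q qE] := @polyfun_coord R _ (lshift m i); exists q => x; rewrite mxE -qE. Qed.

Lemma poly_rsub n m (i : 'I_m) : polyfun (fun z : 'rV[R]_(n + m) => rsubmx z 0 i).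
Proof. by have [q qE] := @polyfun_coord R _ (rshift n i); exists q => x; rewrite mxE -qE. Qed.

Lemma is_scurve_coord n (X : set 'rV[R]_n) (g : R -> 'rV[R]_n) i :
  is_curve S X g -> is_scurve (fun t => g t 0 i).
Proof.
move=> /(is_curve_sub (@subsetT _ X)).
apply: (is_scurve_fun (p := fun x => x 0 i)) => [|x _].
  have d := definable_eq S (poly_rsub n (0 : 'I_1)) (poly_lsub 1 i).
  by apply: (definable_ext d) => z /=; split=> // -[].
by apply: cvg_within_filter; apply: mx_cvg_coord.
Qed.

Lemma is_scurve_cst (c : R) : is_scurve (fun=> c).
Proof.
exists 1 => //; split=> //.
  apply/definable_graph.
  have d := definable_eq S (poly_rsub 1 (0 : 'I_1)) (polyfun_cst _ c).
  have cl : coordmap (fun z : 'rV[R]_(1 + 1) => lsubmx z).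
    by apply: coordmap_lsub; exact: coordmap_id.
  apply: (definable_ext (definableI (definable_preimage cl (definable_itv S 1)) d)).
  by move=> z /=; split=> -[? ?]; split=> //; apply/eq_scalar11.
by apply/curve_continuousP => t _; exact: cvg_cst.
Qed.

Lemma is_scurveN g : is_scurve g -> is_scurve (fun t => - g t).
Proof.
move=> gs.
suff : is_scurve ((fun x : 'rV[R]_1 => - x 0 0) \o (fun t => (g t)%:M)).
  by apply: is_scurve_eq => t /=; rewrite mxE.
apply: is_scurve_fun gs => [|x _].
  have d := definable_eq S (poly_rsub 1 (0 : 'I_1)) (polyfunN (poly_lsub 1 (0 : 'I_1))).
  by apply: (definable_ext d) => z /=; split=> // -[].
by apply: cvg_within_filter; apply: cvgN; apply: mx_cvg_coord.
Qed.

Lemma is_scurve2 (f : R -> R -> R) (g h : R -> R) :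
  definable S [set z : 'rV[R]_((1 + 1) + 1) |
    rsubmx z 0 0 = f (lsubmx (lsubmx z) 0 0) (rsubmx (lsubmx z) 0 0)] ->
  (forall x : 'rV[R]_(1 + 1),
    (fun y : 'rV[R]_(1 + 1) => f (lsubmx y 0 0) (rsubmx y 0 0)) @ x -->
    f (lsubmx x 0 0) (rsubmx x 0 0)) ->
  is_scurve g -> is_scurve h -> is_scurve (fun t => f (g t) (h t)).
Proof.
move=> df fc gs hs.
suff : is_scurve ((fun x : 'rV[R]_(1 + 1) => f (lsubmx x 0 0) (rsubmx x 0 0)) \o
    (fun t => row_mx (g t)%:M (h t)%:M)).
  by apply: is_scurve_eq => t /=; rewrite row_mxKl row_mxKr !mxE.
apply: is_scurve_fun (is_curve_row gs hs) => [|x _].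
  by apply: (definable_ext df) => z /=; split=> // -[].
by apply: cvg_within_filter; exact: fc.
Qed.

Lemma poly_llsub (i : 'I_1) :
  polyfun (fun z : 'rV[R]_((1 + 1) + 1) => lsubmx (lsubmx z) 0 i).
Proof.
by have [q qE] := @polyfun_coord R _ (lshift 1 (lshift 1 i)); exists q => x; rewrite !mxE -qE.
Qed.

Lemma poly_lrsub (i : 'I_1) :
  polyfun (fun z : 'rV[R]_((1 + 1) + 1) => rsubmx (lsubmx z) 0 i).
Proof.
by have [q qE] := @polyfun_coord R _ (lshift 1 (rshift 1 i)); exists q => x; rewrite !mxE -qE.
Qed.

Lemma lsub_cvg (x : 'rV[R]_(1 + 1)) :
  (fun y : 'rV[R]_(1 + 1) => lsubmx y 0 0) @ x --> lsubmx x 0 0.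
Proof.
rewrite mxE (_ : (fun y => _) = fun y : 'rV[R]_(1 + 1) => y 0 (lshift 1 0)).
  exact: (@coord_continuous R 1 _ 0 (lshift 1 0) x).
by apply/funext => y; rewrite mxE.
Qed.

Lemma rsub_cvg (x : 'rV[R]_(1 + 1)) :
  (fun y : 'rV[R]_(1 + 1) => rsubmx y 0 0) @ x --> rsubmx x 0 0.
Proof.
rewrite mxE (_ : (fun y => _) = fun y : 'rV[R]_(1 + 1) => y 0 (rshift 1 0)).
  exact: (@coord_continuous R 1 _ 0 (rshift 1 0) x).
by apply/funext => y; rewrite mxE.
Qed.

Lemma is_scurveD g h : is_scurve g -> is_scurve h -> is_scurve (fun t => g t + h t).
Proof.
apply: (is_scurve2 (f := fun x y => x + y)) => [|x].
  apply: definable_eq; first exact: poly_rsub.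
  by apply: polyfunD; [exact: poly_llsub|exact: poly_lrsub].
exact: (cvgD (@lsub_cvg x) (@rsub_cvg x)).
Qed.

Lemma is_scurveM g h : is_scurve g -> is_scurve h -> is_scurve (fun t => g t * h t).
Proof.
apply: (is_scurve2 (f := fun x y => x * y)) => [|x].
  apply: definable_eq; first exact: poly_rsub.
  by apply: polyfunM; [exact: poly_llsub|exact: poly_lrsub].
exact: (cvgM (@lsub_cvg x) (@rsub_cvg x)).
Qed.

Lemma definable_coord_eq (c : R) : definable S [set x : 'rV[R]_1 | x 0 0 = c].
Proof. by apply: definable_eq; [exact: polyfun_coord|exact: polyfun_cst]. Qed.

Lemma is_scurveV g : is_scurve g -> is_scurve (fun t => (g t)^-1).
Proof.
move=> gs; have [H|H] := curve_dichotomy gs (definable_coord_eq 0).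
  apply: is_curve_eq (is_scurve_cst 0) _; apply: filterS H => t /=.
  by rewrite mxE mulr1n => ->; rewrite invr0.
have := is_curve_near (Y := [set x | x 0 0 <> 0]) gs H => {}gs.
suff : is_scurve ((fun x : 'rV[R]_1 => (x 0 0)^-1) \o (fun t => (g t)%:M)).
  by apply: is_scurve_eq => t /=; rewrite mxE.
apply: is_scurve_fun gs => [|x /= /eqP x0].
  have d := definable_eq S
    (polyfunM (poly_rsub 1 (0 : 'I_1)) (poly_lsub 1 (0 : 'I_1))) (polyfun_cst _ 1).
  apply: (definable_ext d) => z /=; split=> [z1|[/eqP z0 ->]]; last exact: mulVf.
  have z00 : lsubmx z 0 0 != 0.
    by apply: contraPneq z1 => ->; rewrite mulr0 => /esym/eqP; rewrite oner_eq0.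
    have /eqP z0 := z00.
  by split; [exact: z0|apply: (mulIf z00); rewrite z1 mulVf].
apply: cvg_within_filter; exact: (cvgV x0 (@coord_continuous R 1 1 0 0 x)).
Qed.

Lemma sqrt_cvg (x : R) : Num.sqrt @ x --> Num.sqrt x.
Proof.
apply/(@cvgrPdist_lt R R^o) => e e0.
have : \forall y \near x, `|x - y| < e ^+ 2.
  by exists (e ^+ 2) => //=; rewrite exprn_gt0.
apply: filterS => y xy.
have key (a b : R) : a <= b -> `|a - b| < e ^+ 2 -> `|Num.sqrt a - Num.sqrt b| < e.
  move=> ab; rewrite distrC ger0_norm ?subr_ge0 // => abe.
  rewrite distrC ger0_norm ?subr_ge0 ?ler_wsqrtr //.
  case: (lerP 0 b) => b0; last by rewrite !ltr0_sqrtr ?subrr ?(le_lt_trans ab).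
  case: (lerP 0 a) => a0.
    have := sqr_sqrtr a0; have := sqr_sqrtr b0.
    have := sqrtr_ge0 a; have := sqrtr_ge0 b.
    have := ler_wsqrtr ab.
    nra.
  rewrite (ltr0_sqrtr a0) subr0 -(ger0_norm (ltW e0)) -sqrtr_sqr ltr_sqrt ?exprn_gt0 //.
  by apply: le_lt_trans abe; rewrite lerBrDr gerDl ltW.
case/orP: (le_total x y) => [|yx]; first by move/key; exact.
by rewrite distrC; apply: key => //; rewrite distrC.
Qed.

Lemma is_scurve_sqrt g : is_scurve g -> is_scurve (fun t => Num.sqrt (g t)).
Proof.
move=> gs.
suff : is_scurve ((fun x : 'rV[R]_1 => Num.sqrt (x 0 0)) \o (fun t => (g t)%:M)).
  by apply: is_scurve_eq => t /=; rewrite mxE.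
apply: is_scurve_fun gs => [|x _].
  pose l := poly_lsub 1 (0 : 'I_1); pose r := poly_rsub 1 (0 : 'I_1).
  have d1 := definable_eq S (polyfunM r r) l.
  have d2 := definable_ge0 S r.
  have d3 := definable_gt0 S (polyfunN l).
  have d4 := definable_eq S r (polyfun_cst _ 0).
  apply: (definable_ext (definableU (definableI d1 d2) (definableI d3 d4))) => z /=.
  set a := lsubmx z 0 0; set b := rsubmx z 0 0; split.
    case=> [[<- b0]|[]]; first by rewrite -expr2 sqrtr_sqr ger0_norm.
    by rewrite oppr_gt0 => /ltr0_sqrtr -> ->.
  case=> _ ->; case: (ltP a 0) => a0; [right|left].
    by rewrite oppr_gt0 a0 ltr0_sqrtr.
  by rewrite -expr2 sqr_sqrtr ?sqrtr_ge0.
apply: cvg_within_filter; apply: (cvg_comp _ _ _ (@sqrt_cvg _)); exact: mx_cvg_coord.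
Qed.

End scalar_curves.


(* \widetilde R, obtained from R^1; scalars are read off with germ_val. *)
Definition germ_field (R : rcfType) (S : ominimal R) := tilde S [set: 'rV[R]_1].

Section germ_field.
Context {R : rcfType} (S : ominimal R).
Local Notation K := (germ_field S).

HB.instance Definition _ := Choice.on K.

Definition germ (g : R -> R) (gP : is_scurve S g) : K :=
  \pi_(tilde S [set: 'rV[R]_1]) (Curve gP).

Definition germ_val (x : K) (t : R) : R := repr x t 0 0.

Lemma germ_valP (x : K) : is_scurve S (germ_val x).
Proof. exact: is_scurve_coord (curveP (repr x)). Qed.

Lemma germ_valE g (gP : is_scurve S g) :
  \forall t \near 0^'+, germ_val (germ gP) t = g t.
Proof.
by apply: filterS (repr_germ (Curve gP)) => t tE; rewrite /germ_val tE mxE.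
Qed.

Lemma eq_germ_val (x y : K) :
  x = y <-> \forall t \near 0^'+, germ_val x t = germ_val y t.
Proof.
split=> [->|xy]; first exact: filterE.
rewrite -[x]reprK -[y]reprK; apply/eq_germ; apply: filterS xy => t xy.
by apply/rowP => j; rewrite !ord1.
Qed.

Definition germ_cst c : K := germ (is_scurve_cst S c).
Definition germ_add (x y : K) : K := germ (is_scurveD (germ_valP x) (germ_valP y)).
Definition germ_opp (x : K) : K := germ (is_scurveN (germ_valP x)).
Definition germ_mul (x y : K) : K := germ (is_scurveM (germ_valP x) (germ_valP y)).
Definition germ_inv (x : K) : K := germ (is_scurveV (germ_valP x)).
Definition germ_sqrt (x : K) : K := germ (is_scurve_sqrt (germ_valP x)).

Lemma germ_cstE c : \forall t \near 0^'+, germ_val (germ_cst c) t = c.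
Proof. exact: germ_valE. Qed.
Lemma germ_addE x y : \forall t \near 0^'+,
  germ_val (germ_add x y) t = germ_val x t + germ_val y t.
Proof. exact: germ_valE. Qed.
Lemma germ_oppE x : \forall t \near 0^'+, germ_val (germ_opp x) t = - germ_val x t.
Proof. exact: germ_valE. Qed.
Lemma germ_mulE x y : \forall t \near 0^'+,
  germ_val (germ_mul x y) t = germ_val x t * germ_val y t.
Proof. exact: germ_valE. Qed.
Lemma germ_invE x : \forall t \near 0^'+, germ_val (germ_inv x) t = (germ_val x t)^-1.
Proof. exact: germ_valE. Qed.
Lemma germ_sqrtE x : \forall t \near 0^'+,
  germ_val (germ_sqrt x) t = Num.sqrt (germ_val x t).
Proof. exact: germ_valE. Qed.

Lemma germ_addA : associative germ_add.
Proof.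
move=> x y z; apply/eq_germ_val; near=> t.
rewrite (near (germ_addE x (germ_add y z)) t) // (near (germ_addE y z) t) //.
rewrite (near (germ_addE (germ_add x y) z) t) // (near (germ_addE x y) t) //.
exact: addrA.
Unshelve. all: by end_near. Qed.

Lemma germ_addC : commutative germ_add.
Proof.
move=> x y; apply/eq_germ_val; near=> t.
rewrite (near (germ_addE x y) t) // (near (germ_addE y x) t) //.
exact: addrC.
Unshelve. all: by end_near. Qed.

Lemma germ_add0 : left_id (germ_cst 0) germ_add.
Proof.
move=> x; apply/eq_germ_val; near=> t.
rewrite (near (germ_addE (germ_cst 0) x) t) // (near (germ_cstE 0) t) //.
exact: add0r.
Unshelve. all: by end_near. Qed.

Lemma germ_addN : left_inverse (germ_cst 0) germ_opp germ_add.
Proof.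
move=> x; apply/eq_germ_val; near=> t.
rewrite (near (germ_addE (germ_opp x) x) t) // (near (germ_oppE x) t) //.
rewrite (near (germ_cstE 0) t) //; exact: addNr.
Unshelve. all: by end_near. Qed.

HB.instance Definition _ := GRing.isZmodule.Build K
  germ_addA germ_addC germ_add0 germ_addN.

Lemma germ_mulA : associative germ_mul.
Proof.
move=> x y z; apply/eq_germ_val; near=> t.
rewrite (near (germ_mulE x (germ_mul y z)) t) // (near (germ_mulE y z) t) //.
rewrite (near (germ_mulE (germ_mul x y) z) t) // (near (germ_mulE x y) t) //.
exact: mulrA.
Unshelve. all: by end_near. Qed.

Lemma germ_mulC : commutative germ_mul.
Proof.
move=> x y; apply/eq_germ_val; near=> t.
rewrite (near (germ_mulE x y) t) // (near (germ_mulE y x) t) //.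
exact: mulrC.
Unshelve. all: by end_near. Qed.

Lemma germ_mul1 : left_id (germ_cst 1) germ_mul.
Proof.
move=> x; apply/eq_germ_val; near=> t.
rewrite (near (germ_mulE (germ_cst 1) x) t) // (near (germ_cstE 1) t) //.
exact: mul1r.
Unshelve. all: by end_near. Qed.

Lemma germ_mulDl : left_distributive germ_mul germ_add.
Proof.
move=> x y z; apply/eq_germ_val; near=> t.
rewrite (near (germ_mulE (germ_add x y) z) t) // (near (germ_addE x y) t) //.
rewrite (near (germ_addE (germ_mul x z) (germ_mul y z)) t) //.
rewrite (near (germ_mulE x z) t) // (near (germ_mulE y z) t) //.
exact: mulrDl.
Unshelve. all: by end_near. Qed.

Lemma germ_1neq0 : germ_cst 1 != germ_cst 0.
Proof.
apply/negP => /eqP/eq_germ_val H.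
have : \forall t \near (0 : R)^'+, False.
  apply: filterS3 H (germ_cstE 1) (germ_cstE 0) => t + e1 e0.
  by rewrite e1 e0 => /eqP; rewrite oner_eq0.
by move/filter_ex => [].
Qed.

HB.instance Definition _ := GRing.Zmodule_isComNzRing.Build K
  germ_mulA germ_mulC germ_mul1 germ_mulDl germ_1neq0.

Lemma germ_val0 : \forall t \near 0^'+, germ_val 0 t = 0.
Proof. exact: germ_cstE. Qed.
Lemma germ_val1 : \forall t \near 0^'+, germ_val 1 t = 1.
Proof. exact: germ_cstE. Qed.
Lemma germ_valD (x y : K) :
  \forall t \near 0^'+, germ_val (x + y) t = germ_val x t + germ_val y t.
Proof. exact: germ_addE. Qed.
Lemma germ_valN (x : K) : \forall t \near 0^'+, germ_val (- x) t = - germ_val x t.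
Proof. exact: germ_oppE. Qed.
Lemma germ_valM (x y : K) :
  \forall t \near 0^'+, germ_val (x * y) t = germ_val x t * germ_val y t.
Proof. exact: germ_mulE. Qed.

Lemma germ_dichotomy (x : K) (P : set 'rV[R]_1) : definable S P ->
  (\forall t \near 0^'+, P (germ_val x t)%:M) \/
  (\forall t \near 0^'+, ~ P (germ_val x t)%:M).
Proof. exact: curve_dichotomy (germ_valP x). Qed.

Lemma germ_mulV (x : K) : x != 0 -> germ_inv x * x = 1.
Proof.
move=> x0; have [H|H] := germ_dichotomy x (definable_coord_eq S 0).
  case/eqP: x0; apply/eq_germ_val; apply: filterS2 H germ_val0 => t /=.
  by rewrite mxE mulr1n => -> H0; exact/esym.
apply/eq_germ_val; near=> t.
rewrite (near (germ_valM (germ_inv x) x) t) // (near (germ_invE x) t) //.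
rewrite (near germ_val1 t) // mulVf //; apply/eqP.
by have := near H t; rewrite /= mxE mulr1n; exact.
Unshelve. all: by end_near. Qed.

Lemma germ_inv0 : germ_inv 0 = 0.
Proof.
apply/eq_germ_val; near=> t.
by rewrite (near (germ_invE 0) t) // (near germ_val0 t) // invr0.
Unshelve. all: by end_near. Qed.

HB.instance Definition _ := GRing.ComNzRing_isField.Build K germ_mulV germ_inv0.

Definition germ_le (x y : K) : bool :=
  `[< \forall t \near 0^'+, germ_val x t <= germ_val y t >].
Definition germ_lt (x y : K) : bool := (y != x) && germ_le x y.
Definition germ_norm (x : K) : K := if germ_le 0 x then x else - x.

Lemma germ_ge0P (x : K) :
  germ_le 0 x <-> \forall t \near 0^'+, 0 <= germ_val x t.
Proof.
split=> [/asboolP|] H; [|apply/asboolP];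
  by apply: filterS2 H germ_val0 => t + e; rewrite e.
Qed.

Lemma germ_le0P (x : K) :
  germ_le x 0 <-> \forall t \near 0^'+, germ_val x t <= 0.
Proof.
split=> [/asboolP|] H; [|apply/asboolP];
  by apply: filterS2 H germ_val0 => t + e; rewrite e.
Qed.

Lemma germ_le0_add (x y : K) : germ_le 0 x -> germ_le 0 y -> germ_le 0 (x + y).
Proof.
move=> /germ_ge0P x0 /germ_ge0P y0; apply/germ_ge0P.
by apply: filterS3 x0 y0 (germ_valD x y) => t ? ? ->; exact: addr_ge0.
Qed.

Lemma germ_le0_mul (x y : K) : germ_le 0 x -> germ_le 0 y -> germ_le 0 (x * y).
Proof.
move=> /germ_ge0P x0 /germ_ge0P y0; apply/germ_ge0P.
by apply: filterS3 x0 y0 (germ_valM x y) => t ? ? ->; exact: mulr_ge0.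
Qed.

Lemma germ_le0_anti (x : K) : germ_le 0 x -> germ_le x 0 -> x = 0.
Proof.
move=> /germ_ge0P x0 /germ_le0P x0'; apply/eq_germ_val.
apply: filterS3 x0 x0' germ_val0 => t ? ? ->.
by apply/le_anti/andP.
Qed.

Lemma germ_sub_ge0 (x y : K) : germ_le 0 (y - x) = germ_le x y.
Proof.
have E : \forall t \near 0^'+, germ_val (y - x) t = germ_val y t - germ_val x t.
  by apply: filterS2 (germ_valD y (- x)) (germ_valN x) => t -> ->.
apply/idP/idP => [/germ_ge0P H|/asboolP H].
  by apply/asboolP; apply: filterS2 E H => t ->; rewrite subr_ge0.
by apply/germ_ge0P; apply: filterS2 E H => t ->; rewrite subr_ge0.
Qed.

Lemma germ_le0_total (x : K) : germ_le 0 x || germ_le x 0.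
Proof.
have [H|H] := germ_dichotomy x (definable_ge0 S (polyfun_coord (0 : 'I_1))).
  apply/orP; left; apply/germ_ge0P; apply: filterS H => t /=.
  by rewrite mxE mulr1n.
apply/orP; right; apply/germ_le0P; apply: filterS H => t /=.
by rewrite mxE mulr1n => /negP; rewrite -ltNge => /ltW.
Qed.

Lemma germ_normN (x : K) : germ_norm (- x) = germ_norm x.
Proof.
have E (y : K) : germ_le 0 (- y) = germ_le y 0 by rewrite -sub0r germ_sub_ge0.
rewrite /germ_norm E opprK.
have := germ_le0_total x; have := @germ_le0_anti x.
case: (germ_le 0 x); case: (germ_le x 0) => //= H _.
by rewrite H // oppr0.
Qed.

Lemma germ_ge0_norm (x : K) : germ_le 0 x -> germ_norm x = x.
Proof. by rewrite /germ_norm => ->. Qed.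

HB.instance Definition _ := Num.IntegralDomain_isLeReal.Build K
  germ_le0_add germ_le0_mul germ_le0_anti germ_sub_ge0 germ_le0_total
  germ_normN germ_ge0_norm (fun _ _ => erefl).
HB.instance Definition _ := Num.RealField.on K.

Lemma germ_geP (x y : K) :
  x <= y <-> \forall t \near 0^'+, germ_val x t <= germ_val y t.
Proof. by split=> /asboolP. Qed.

Lemma germ_sqrt_ge0 (x : K) : 0 <= germ_sqrt x.
Proof.
by apply/germ_ge0P; apply: filterS (germ_sqrtE x) => t ->; exact: sqrtr_ge0.
Qed.

Lemma sqr_germ_sqrt (x : K) : 0 <= x -> germ_sqrt x ^+ 2 = x.
Proof.
move=> /germ_ge0P x0; apply/eq_germ_val.
apply: filterS3 x0 (germ_sqrtE x) (germ_valM (germ_sqrt x) (germ_sqrt x)).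
by move=> t t0 sE ->; rewrite sE -expr2 sqr_sqrtr.
Qed.

End germ_field.

(* \widetilde R^n; the alias carries the topology whose basis is the open balls
   with radii in \widetilde R. *)
Definition euclidean (R : rcfType) (S : ominimal R) (n : nat) :=
  'rV[germ_field S]_n.

Section euclidean.
Context {R : rcfType} (S : ominimal R) (n : nat).
Local Notation K := (germ_field S).
Local Notation E := (euclidean S n).

HB.instance Definition _ := GRing.Zmodule.on E.
HB.instance Definition _ := isPointed.Build E 0.
HB.instance Definition _ := isPointed.Build K 0.

(* germ_sqrt is the square root of \widetilde R on nonnegative elements
   (germ_sqrt_ge0, sqr_germ_sqrt). *)
Definition enorm (x : E) : K := germ_sqrt (\sum_i (x : 'rV[K]_n) 0 i ^+ 2).

Definition eball (x : E) (r : K) : set E := [set y | enorm (y - x) < r].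

Lemma enorm_sum_ge0 (x : E) : 0 <= \sum_i (x : 'rV[K]_n) 0 i ^+ 2.
Proof. by apply: sumr_ge0 => i _; exact: sqr_ge0. Qed.

Lemma enorm_ge0 (x : E) : 0 <= enorm x.
Proof. exact: germ_sqrt_ge0. Qed.

Lemma enorm0 : enorm 0 = 0.
Proof.
apply/eqP; rewrite -sqrf_eq0 sqr_germ_sqrt ?enorm_sum_ge0 //.
by rewrite big1 // => i _; rewrite mxE expr0n.
Qed.

Lemma ler_enormD (x y : E) : enorm (x + y) <= enorm x + enorm y.
Proof.
have := enorm_ge0 x; have := enorm_ge0 y; have := enorm_ge0 (x + y).
have := sqr_germ_sqrt (enorm_sum_ge0 x); have := sqr_germ_sqrt (enorm_sum_ge0 y).
have := sqr_germ_sqrt (enorm_sum_ge0 (x + y)).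
rewrite -/(enorm x) -/(enorm y) -/(enorm (x + y)).
set u := enorm x; set v := enorm y; set w := enorm (x + y) => wE vE uE w0 v0 u0.
pose c := \sum_i (x : 'rV[K]_n) 0 i * (y : 'rV[K]_n) 0 i.
have wE' : w ^+ 2 = u ^+ 2 + v ^+ 2 + c *+ 2.
  rewrite wE vE uE /c -sumrMnl -!big_split; apply: eq_bigr => i _ /=.
  by rewrite mxE sqrrD addrAC.
have cauchy : u * v * c <= (u * v) ^+ 2.
  have : 0 <= \sum_i (v * (x : 'rV[K]_n) 0 i - u * (y : 'rV[K]_n) 0 i) ^+ 2.
    by apply: sumr_ge0 => i _; exact: sqr_ge0.
  have -> : \sum_i (v * (x : 'rV[K]_n) 0 i - u * (y : 'rV[K]_n) 0 i) ^+ 2 =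
      v ^+ 2 * u ^+ 2 + u ^+ 2 * v ^+ 2 - 2 * (u * v) * c.
    rewrite [in v ^+ 2 * u ^+ 2]uE [in u ^+ 2 * v ^+ 2]vE /c !mulr_sumr -big_split -sumrB.
    by apply: eq_bigr => i _ /=; ring.
  by nra.
have c_le : c <= u * v.
  have [uv0|] := ltP 0 (u * v).
    by move: cauchy; rewrite expr2 ler_pM2l.
  move=> uv0; have /eqP : u * v = 0 by apply/le_anti; rewrite uv0 mulr_ge0.
  have zero (z : E) : enorm z = 0 -> forall i, (z : 'rV[K]_n) 0 i = 0.
    move=> z0 i; have := sqr_germ_sqrt (enorm_sum_ge0 z).
    rewrite -/(enorm z) z0 expr0n /= => /esym/eqP.
    rewrite psumr_eq0 => [/allP /(_ i)|j _]; last exact: sqr_ge0.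
    by rewrite mem_index_enum sqrf_eq0 => /(_ isT)/eqP.
  rewrite mulf_eq0 => /orP[] /eqP /zero z0; rewrite /c big1 ?mulr_ge0 // => i _.
    by rewrite z0 mul0r.
  by rewrite z0 mulr0.
by nra.
Qed.

Lemma enormN (x : E) : enorm (- x) = enorm x.
Proof. by congr germ_sqrt; apply: eq_bigr => i _; rewrite mxE sqrrN. Qed.

Lemma eball_cover : \bigcup_(xr in [set xr : E * K | 0 < xr.2]) eball xr.1 xr.2 = setT.
Proof.
apply/seteqP; split=> // x _; exists (x, 1) => /=; first exact: ltr01.
by rewrite /eball /= subrr enorm0 ltr01.
Qed.

Lemma eball_join (i j : E * K) (t : E) : 0 < i.2 -> 0 < j.2 ->
  eball i.1 i.2 t -> eball j.1 j.2 t ->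
  exists k : E * K, [/\ 0 < k.2, eball k.1 k.2 t &
    eball k.1 k.2 `<=` eball i.1 i.2 `&` eball j.1 j.2].
Proof.
move=> _ _; rewrite /eball /= => it jt.
exists (t, Num.min (i.2 - enorm (t - i.1)) (j.2 - enorm (t - j.1))) => /=.
have r0 : 0 < Num.min (i.2 - enorm (t - i.1)) (j.2 - enorm (t - j.1)).
  by rewrite lt_min !subr_gt0 it jt.
split=> //; first by rewrite subrr enorm0.
move=> y /=; rewrite lt_min !ltrBrDr => /andP[yi yj]; split.
  by apply: le_lt_trans yi; rewrite (le_trans _ (ler_enormD _ _)) // addrA subrK.
by apply: le_lt_trans yj; rewrite (le_trans _ (ler_enormD _ _)) // addrA subrK.
Qed.

HB.instance Definition _ := isBaseTopological.Build E eball_cover eball_join.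

Lemma eball_open (x : E) (r : K) : 0 < r -> open (eball x r).
Proof.
move=> r0; exists [set (x, r)] => /=; first by move=> _ ->.
by rewrite bigcup_set1.
Qed.

Lemma euclidean_openP (A : set E) :
  open A <-> forall x, A x -> exists2 r : K, 0 < r & eball x r `<=` A.
Proof.
split=> [[D' D0 <-] x [[y r] D'y xy]|H].
  have r0 := D0 _ D'y; exists (r - enorm (x - y)); first by rewrite subr_gt0.
  move=> z zx; exists (y, r) => //; move: zx xy; rewrite /eball /= ltrBrDr => zx xy.
  by apply: le_lt_trans zx; rewrite (le_trans _ (ler_enormD _ _)) // addrA subrK.
exists [set xr | 0 < xr.2 /\ eball xr.1 xr.2 `<=` A]; first by move=> [x r] [].
apply/seteqP; split; first by move=> x [[y r] [_ s]] /s.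
move=> x Ax; have [r r0 rA] := H _ Ax; exists (x, r) => //=.
by rewrite /eball /= subrr enorm0.
Qed.

End euclidean.

Section tilde_topology.
Context {R : rcfType} (S : ominimal R) (n : nat) (X : set 'rV[R]_n).

(* the inclusion of \widetilde X in \widetilde R^n, via coordinate germs *)
Definition tilde_incl (x : tilde S X) : euclidean S n :=
  \row_i germ (is_scurve_coord i (curveP (repr x))).

Lemma tilde_inclE (g : curve S X) (i : 'I_n) :
  tilde_incl (\pi_(tilde S X) g) 0 i = germ (is_scurve_coord i (curveP g)).
Proof.
rewrite mxE; apply/eq_germ; apply: filterS (repr_germ g) => t /= ->.
by [].
Qed.

Lemma tilde_incl_inj : injective tilde_incl.
Proof.
move=> x y xy; rewrite -[x]reprK -[y]reprK; apply/eq_germ.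
have : \forall t \near (0 : R)^'+, forall i, repr x t 0 i = repr y t 0 i.
  apply: filter_forall => i; have := congr1 (fun z : 'rV[germ_field S]_n => z 0 i) xy.
  rewrite !mxE => /eq_germ; apply: filterS => t /= /(congr1 (fun z : 'rV[R]_1 => z 0 0)).
  by rewrite !mxE !mulr1n; exact.
by apply: filterS => t H; apply/rowP.
Qed.

HB.instance Definition _ :=
  Topological.copy (tilde S X) (initial_topology tilde_incl).

End tilde_topology.

(* Main.v *)
(* Given germs gamma and eps > 0, let A be the set of the (t, y) with y in X and
   |f y - f (gamma t)| >= eps t. The distance h t from (t, gamma t) to A, truncated
   at 1, is definable, is continuous because distance functions are 1-Lipschitz,
   and is positive because f, gamma and eps are continuous. So its germ is a
   radius in \widetilde R, and |eta - gamma| < h forces |f eta - f gamma| < eps. *)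
Require Import Defs.
From mathcomp Require Import all_boot all_order all_algebra.
From mathcomp Require Import boolp classical_sets functions topology normedtype.
From mathcomp Require Import lra.
Set Implicit Arguments.
Unset Strict Implicit.
Unset Printing Implicit Defensive.
Import Order.TTheory GRing.Theory Num.Theory numFieldNormedType.Exports.
Local Open Scope classical_set_scope.
Local Open Scope ring_scope.

(** * The maximum norm on row vectors *)

Section row_norm.
Context {R : rcfType}.

(** The norm is the maximum of the absolute values of the coordinates. It is 0 when [n = 0], where
    the coordinates impose nothing on [d]; hence the separate [0 < d]. *)
Lemma rV_norm_ltP n (x : 'rV[R]_n) (d : R) :
  `|x| < d <-> 0 < d /\ forall i, `|x 0 i| < d.
Proof.
rewrite [`|x|]/Num.Def.normr /= mx_normrE; split=> [/bigmax_ltP[d0 xd]|[d0 xd]].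
  by split=> // i; exact: (xd (0, i)).
by apply/bigmax_ltP; split=> // -[i j] _; rewrite ord1; exact: xd.
Qed.

Lemma row_mx_norm_lt n m (x : 'rV[R]_n) (y : 'rV[R]_m) (d : R) :
  `|row_mx x y| < d <-> `|x| < d /\ `|y| < d.
Proof.
split=> [/rV_norm_ltP[d0 xyd]|[/rV_norm_ltP[d0 xd] /rV_norm_ltP[_ yd]]].
  split; apply/rV_norm_ltP; split=> // i.
    by rewrite -(row_mxEl x y); exact: xyd.
  by rewrite -(row_mxEr x y); exact: xyd.
apply/rV_norm_ltP; split=> // i; rewrite mxE.
by case: fintype.splitP => j _; [exact: xd|exact: yd].
Qed.

Lemma scalar_norm_lt (a d : R) : `|a%:M : 'rV[R]_1| < d <-> `|a| < d.
Proof.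
split=> [/rV_norm_ltP[_ /(_ 0)]|ad]; first by rewrite mxE mulr1n.
apply/rV_norm_ltP; split=> [|i]; first exact: le_lt_trans ad.
by rewrite ord1 mxE mulr1n.
Qed.

End row_norm.

(** * Suprema of definable sets, and closure properties of definability *)

Section definable_sets.
Context {R : rcfType} (S : ominimal R).

(** The bound [M] rules out the sets unbounded above; otherwise the supremum is the point or the
    right endpoint, because the order is dense. Nonemptiness excludes []a, b[] with [b <= a]. *)
Lemma point_or_open_itv_lub (B : set R) (M : R) : point_or_open_itv B ->
  B !=set0 -> (forall x, B x -> x <= M) ->
  exists s, (forall x, B x -> x <= s) /\
    (forall u, (forall x, B x -> x <= u) -> s <= u).
Proof.
have itvy (a : R) : ~ (forall x, a < x -> x <= M).
  move=> /(_ (Num.max a M + 1)); have := le_max M a M; rewrite lexx orbT.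
  have := le_max a a M; rewrite lexx /= => aM MM H.
  have /H : a < Num.max a M + 1 by rewrite (le_lt_trans aM) // ltrDl ltr01.
  by rewrite leNgt (le_lt_trans MM) // ltrDl ltr01.
have dense (b c : R) : c < b -> exists2 x, c < x & x < b.
  by move=> cb; exists ((c + b) / 2); rewrite midf_lt.
case=> [a|a b|b|a|] [x Bx] BM.
- by exists a; split=> [y ->//|u]; apply.
- move: Bx => /=; rewrite in_itv /= => /andP[ax xb].
  exists b; split=> [y /=|u bu]; first by rewrite in_itv /= => /andP[_ /ltW].
  rewrite leNgt; apply/negP => ub.
  have [y] : exists2 y, Num.max x u < y & y < b.
    by apply: dense; rewrite gt_max xb.
  rewrite gt_max => /andP[xy uy] yb; have := bu y.
  rewrite /= in_itv /= (lt_trans ax xy) yb => /(_ isT).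
  by rewrite leNgt uy.
- exists b; split=> [y /=|u bu]; first by rewrite in_itv /= => /ltW.
  rewrite leNgt; apply/negP => /dense[y uy yb].
  by have := bu y; rewrite /= in_itv /= yb leNgt uy => /(_ isT).
- by case: (itvy a) => y ay; apply: BM; rewrite /= in_itv /= ay.
- by case: (itvy 0) => y ay; apply: BM; rewrite /= in_itv.
Qed.

(* Order completeness fails in R, but not for definable sets. *)
Lemma definable_lub (A : set 'rV[R]_1) (a M : R) : definable S A ->
  A a%:M -> (forall x, A x%:M -> x <= M) ->
  exists s, (forall x, A x%:M -> x <= s) /\
    (forall u, (forall x, A x%:M -> x <= u) -> s <= u).
Proof.
move=> /definable1[k [B [Bp AB]]] Aa AM.
have AE t : A t%:M <-> exists i, B i t.
  have -> : A t%:M <-> [set x 0 0 | x in A] t.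
    split=> [At|[x Ax <-]]; first by exists t%:M => //; rewrite mxE.
    by rewrite -(_ : x = (x 0 0)%:M) //; apply/eq_scalar11.
  by rewrite AB; split=> [[i _]|[i]]; exists i.
(* Empty pieces have no supremum: they get an arbitrary [s i] and are left out of the maximum
   below. *)
pose P i := `[< B i !=set0 >].
have lub i : exists s, P i -> (forall x, B i x -> x <= s) /\
    (forall u, (forall x, B i x -> x <= u) -> s <= u).
  have [Bi|Bi] := pselect (B i !=set0); last by exists 0 => /asboolP.
  have [|s Hs] := point_or_open_itv_lub (M := M) (Bp i) Bi.
    by move=> x Bx; apply: AM; apply/AE; exists i.
  by exists s.
have [s sP] := choice lub.
have /AE[i0 Ba] := Aa.
have Pi0 : P i0 by apply/asboolP; exists a.
(* The supremum of the finite union is the largest supremum of a nonempty piece. *)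
have [i Pi imax] := arg_maxP s Pi0.
exists (s i); split=> [x /AE[j Bx]|u Au].
  have Pj : P j by apply/asboolP; exists x.
  by apply: le_trans (imax j Pj); exact: (sP j Pj).1.
by apply: (sP i Pi).2 => x Bx; apply: Au; apply/AE; exists i.
Qed.

(** For the maximum norm this is a finite conjunction of polynomial inequalities: [q > 0],
    [q - (u_i - v_i) > 0] and [q + (u_i - v_i) > 0]. *)
Lemma definable_norm_lt n m (u v : 'rV[R]_n -> 'rV[R]_m) (q : 'rV[R]_n -> R) :
  (forall i, polyfun (fun x => u x 0 i)) -> (forall i, polyfun (fun x => v x 0 i)) ->
  polyfun q -> definable S [set x | `|u x - v x| < q x].
Proof.
move=> pu pv pq.
have dl := definable_gt0 S pq.
have d1 i := definable_gt0 S (polyfunD pq (polyfunN (polyfunD (pu i) (polyfunN (pv i))))).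
have d2 i := definable_gt0 S (polyfunD pq (polyfunD (pu i) (polyfunN (pv i)))).
apply: (definable_ext (definableI dl
  (definable_bigI (fun i => definableI (d1 i) (d2 i))))) => x /=; split.
  case=> q0 H; apply/rV_norm_ltP; split=> // i; have [H1 H2] := H i.
  by rewrite !mxE ltr_norml; apply/andP; split; lra.
move=> /rV_norm_ltP[q0 H]; split=> // i; have := H i.
by rewrite !mxE ltr_norml => /andP[? ?]; split; lra.
Qed.

(** Projection of the part of the graph of [g] whose values lie in [P]. Since [definable_ex]
    eliminates the first block, the value is placed before the argument. *)
Lemma definable_fun_preimage n m (D : set 'rV[R]_n) (g : 'rV[R]_n -> 'rV[R]_m)
    (P : set 'rV[R]_m) :
  definable_fun S D g -> definable S P -> definable S [set x | D x /\ P (g x)].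
Proof.
move=> /definable_graph dg dP.
have cid := @coordmap_id R (m + n).
have c1 := coordmap_row (coordmap_rsub cid) (coordmap_lsub cid).
have c2 := coordmap_lsub cid.
apply: (definable_ext (definable_ex (definableI (definable_preimage c1 dg)
  (definable_preimage c2 dP)))) => x /=; split.
  by case=> y; rewrite !row_mxKl !row_mxKr => -[[Dx ->] Py].
by move=> [Dx Pgx]; exists (g x); rewrite !row_mxKl !row_mxKr.
Qed.

Lemma definable_fun_coordmap n m (D : set 'rV[R]_n) (g : 'rV[R]_n -> 'rV[R]_m) :
  definable S D -> coordmap g -> definable_fun S D g.
Proof.
move=> dD [s gs]; apply/definable_graph.
have cl := coordmap_lsub (@coordmap_id R (n + m)).
have dE i := definable_eq S (poly_rsub n i) (poly_lsub m (s i)).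
apply: (definable_ext (definableI (definable_preimage cl dD)
  (definable_bigI dE))) => z /=; split=> -[Dz zE]; split=> //.
  by apply/rowP => i; rewrite zE gs.
by move=> i; rewrite zE gs.
Qed.

End definable_sets.

(** * The truncated distance to a definable set *)

Section distance.
Context {R : rcfType} (S : ominimal R) (n : nat) (A : set 'rV[R]_n).
Hypothesis dA : definable S A.

(** Presenting the infimum as the greatest lower bound [d] makes [definable_lub] applicable. *)
Definition dist_le (x : 'rV[R]_n) (d : R) :=
  d <= 1 /\ forall a, A a -> d <= `|a - x|.

(* The distance to A truncated at 1, so that it also makes sense for A empty. *)
Definition tdist (x : 'rV[R]_n) : R :=
  get [set d | dist_le x d /\ forall e, dist_le x e -> e <= d].

(** The universal quantifier over [a] is the complement of a projection. *)
Lemma definable_dist_le :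
  definable S [set z : 'rV[R]_(n + 1) | dist_le (lsubmx z) (rsubmx z 0 0)].
Proof.
have d1 := definable_ge0 S (polyfunD (polyfun_cst _ 1)
  (polyfunN (poly_rsub n (0 : 'I_1)))).
have cl := coordmap_lsub (@coordmap_id R (n + (n + 1))).
have pa i : polyfun (fun w : 'rV[R]_(n + (n + 1)) => lsubmx w 0 i).
  exact: poly_lsub.
have px i : polyfun (fun w : 'rV[R]_(n + (n + 1)) => lsubmx (rsubmx w) 0 i).
  have [q qE] := @polyfun_coord R _ (rshift n (lshift 1 i)).
  by exists q => x; rewrite !mxE -qE.
have pd : polyfun (fun w : 'rV[R]_(n + (n + 1)) => rsubmx (rsubmx w) 0 0).
  have [q qE] := @polyfun_coord R _ (rshift n (rshift n (0 : 'I_1))).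
  by exists q => x; rewrite !mxE -qE.
have d2 := definableC (definable_ex (definableI (definable_preimage cl dA)
  (definable_norm_lt S pa px pd))).
apply: (definable_ext (definableI d1 d2)) => z /=; rewrite subr_ge0.
split=> -[z1 H]; split=> //.
  move=> a Aa; rewrite leNgt; apply/negP => az; apply: H.
  by exists a; rewrite !row_mxKl !row_mxKr.
case=> a; rewrite !row_mxKl !row_mxKr => -[Aa].
by apply/negP; rewrite -leNgt; exact: H.
Qed.

(** The admissible [d] form a definable set that contains 0 and is bounded by 1, so it has a
    supremum. The supremum is itself admissible, since 1 and every [|a - x|] are upper bounds of the
    set. *)
Lemma tdistP x : dist_le x (tdist x) /\ forall e, dist_le x e -> e <= tdist x.
Proof.
apply: (@getPex _ [set d | dist_le x d /\ forall e, dist_le x e -> e <= d]).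
pose G := [set d : 'rV[R]_1 | dist_le x (d 0 0)].
have dG : definable S G.
  have pu (i : 'I_n) : polyfun (fun w : 'rV[R]_(n + 1) => lsubmx w 0 i).
    exact: poly_lsub.
  (* The fibre over the fixed [x] is cut out by equations with constants of [R]. *)
  have d0 := definable_bigI (fun i => definable_eq S (pu i) (polyfun_cst _ (x 0 i))).
  apply: (definable_ext (definable_ex (definableI d0 definable_dist_le))) => d /=.
  split=> [[y]|xd]; last by exists x; rewrite !row_mxKl !row_mxKr.
  rewrite !row_mxKl !row_mxKr => -[yE]; rewrite (_ : y = x) //.
  by apply/rowP.
have GE d : G d%:M <-> dist_le x d by rewrite /G /= mxE mulr1n.
have G0 : G 0%:M by apply/GE; split; [exact: ler01|move=> a _; exact: normr_ge0].
have [d /GE[]//|s [s1 s2]] := definable_lub (M := 1) dG G0.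
exists s; split; last by move=> e /GE; exact: s1.
split=> [|a Aa]; first by apply: s2 => e /GE[].
by apply: s2 => e /GE[_]; apply.
Qed.

(** By the triangle inequality, [tdist x - |x - y|] is admissible at [y]. *)
Lemma tdist_lip x y : tdist x <= tdist y + `|x - y|.
Proof.
rewrite -lerBlDr; apply: (tdistP y).2.
have [[x1 xA] _] := tdistP x; split=> [|a Aa].
  by rewrite lerBlDr (le_trans x1) // lerDl.
rewrite lerBlDr (le_trans (xA a Aa)) //.
by rewrite (_ : a - x = (a - y) - (x - y)) ?ler_normB // opprB addrA subrK.
Qed.

Lemma tdist_cvg x : tdist @ x --> tdist x.
Proof.
apply/(@cvgrPdist_lt R R^o _ (nbhs x) (nbhs_filter x) tdist) => e e0.
have : \forall y \near x, `|x - y| < e by apply/nbhs_normP; exists e.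
apply: filterS => y xy; apply: le_lt_trans xy.
have xyd := tdist_lip x y; have := tdist_lip y x; rewrite distrC => yxd.
by rewrite ler_norml; apply/andP; split; lra.
Qed.

(** A greatest element is first-order: [d] is admissible and no larger value is. *)
Lemma definable_tdist : definable S
  [set z : 'rV[R]_(n + 1) | rsubmx z 0 0 = tdist (lsubmx z)].
Proof.
have d0 := definable_dist_le.
have cid := @coordmap_id R (1 + (n + 1)).
have cs := coordmap_row (coordmap_lsub (coordmap_rsub cid)) (coordmap_lsub cid).
have pl : polyfun (fun w : 'rV[R]_(1 + (n + 1)) => lsubmx w 0 0).
  exact: poly_lsub.
have pr : polyfun (fun w : 'rV[R]_(1 + (n + 1)) => rsubmx (rsubmx w) 0 0).
  have [q qE] := @polyfun_coord R _ (rshift 1 (rshift n (0 : 'I_1))).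
  by exists q => x; rewrite !mxE -qE.
have d1 := definableC (definable_ex (definableI (definable_preimage cs d0)
  (definable_gt0 S (polyfunD pl (polyfunN pr))))).
apply: (definable_ext (definableI d0 d1)) => z /=; have [H1 H2] := tdistP (lsubmx z).
split=> [[zd H]|zE].
  apply/le_anti; rewrite H2 //= leNgt; apply/negP => lt; apply: H.
  exists (tdist (lsubmx z))%:M; rewrite !row_mxKl !row_mxKr !mxE.
  by rewrite mulr1n subr_gt0; split=> //; move: lt; rewrite mxE.
split; rewrite ?zE // => -[d]; rewrite !row_mxKl !row_mxKr zE subr_gt0 => -[/H2].
by rewrite leNgt => /negP.
Qed.

End distance.

(** * A definable radius of continuity along a curve *)

Section modulus.
Context {R : rcfType} (S : ominimal R).

Lemma is_scurve_id : is_scurve S (fun t => t).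
Proof.
exists 1 => //; split=> //.
  apply: (definable_fun_coordmap (definable_itv S 1)).
  by exists id => x i; rewrite ord1 mxE mulr1n.
apply/curve_continuousP => t _; apply: mx_cvg => j.
by rewrite ord1 mxE; under eq_fun do rewrite mxE; exact: cvg_id.
Qed.

Lemma is_curve_local n (e : R) (g : R -> 'rV[R]_n) (t d : R) :
  {within `]0, e[, continuous g} -> t \in `]0, e[ -> 0 < d ->
  exists2 r, 0 < r & forall s, `|s - t| < r -> `|g s - g t| < d.
Proof.
move=> /curve_continuousP gc te d0.
have /nbhs_normP[r /= r0 H] : \forall s \near t, `|g t - g s| < d.
  have gtd : \forall y \near g t, `|g t - y| < d by apply/nbhs_normP; exists d.
  exact: gc gtd.
by exists r => // s st; rewrite distrC; apply: H; rewrite /= distrC.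
Qed.

Lemma within_continuous_local n m (X : set 'rV[R]_n) (f : 'rV[R]_n -> 'rV[R]_m)
    (x : 'rV[R]_n) (d : R) :
  {within X, continuous f} -> X x -> 0 < d ->
  exists2 r, 0 < r & forall y, X y -> `|y - x| < r -> `|f y - f x| < d.
Proof.
move=> /subspace_continuousP fc Xx d0.
have /nbhs_normP[r /= r0 H] : \forall y \near x, X y -> `|f x - f y| < d.
  have fxd : \forall y \near f x, `|f x - y| < d by apply/nbhs_normP; exists d.
  exact: fc fxd.
exists r => // y Xy yx; rewrite distrC; apply: H => //.
by rewrite /= distrC.
Qed.

(* h t is the distance from (t, g t) to the set of all (s, y) at which the
   conclusion fails: since it is a distance, h is continuous without any appeal
   to the monotonicity theorem. *)
Lemma modulus_curve n m (X : set 'rV[R]_n) (f : 'rV[R]_n -> 'rV[R]_m)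
    (g : R -> 'rV[R]_n) (eps : R -> R) :
  definable_fun S X f -> {within X, continuous f} -> definable S X -> is_curve S X g -> is_scurve S eps ->
  (\forall t \near 0^'+, 0 < eps t) ->
  exists2 h : R -> R, is_scurve S h &
    \forall t \near 0^'+, 0 < h t /\
      forall y, X y -> `|y - g t| < h t -> `|f y - f (g t)| < eps t.
Proof.
move=> fd fc dX gX epsS eps0.
(* Bundling the three functions gives them a common interval []0, e[], on which [g] stays in [X] and
   [eps] is positive throughout. *)
pose c t := row_mx (g t) (row_mx (f (g t)) (eps t)%:M).
have [e e0 [cZ cd cc]] : is_curve S
    [set z : 'rV[R]_(n + (m + 1)) | X (lsubmx z) /\ 0 < rsubmx (rsubmx z) 0 0] c.
  have fT : set_fun X [set: 'rV[R]_m] f by [].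
  have := is_curve_row gX (is_curve_row (is_curve_comp fT fd fc gX) epsS).
  move=> cT; apply: is_curve_near cT _.
  have [d d0 [gdX _ _]] := gX; apply: filterS2 (near0 d0) eps0 => t td et /=.
  by rewrite row_mxKl !row_mxKr mxE mulr1n; split=> //; exact: gdX.
pose D := [set z : 'rV[R]_(1 + n) | (lsubmx z 0 0 \in `]0, e[) /\ X (rsubmx z)].
have cid := @coordmap_id R (1 + n).
have dD : definable S D.
  exact: definableI (definable_preimage (coordmap_lsub cid) (definable_itv S e))
                    (definable_preimage (coordmap_rsub cid) dX).
have dF : definable_fun S D
    (fun z => row_mx (f (rsubmx z)) (c (lsubmx z 0 0))).
  apply: definable_fun_row.
    apply: definable_fun_comp (definable_fun_coordmap dD (coordmap_rsub cid)) fd.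
    by move=> z [].
  apply: (definable_fun_comp _ (definable_fun_coordmap dD (coordmap_lsub cid)) cd).
  by move=> z [].
(* At [v = (f y, c t)] this reads [|f y - f (g t)| < eps t]. *)
pose P := [set v : 'rV[R]_(m + (n + (m + 1))) |
  `| lsubmx v - lsubmx (rsubmx (rsubmx v)) | < rsubmx (rsubmx (rsubmx v)) 0 0].
have dP : definable S P.
  apply: definable_norm_lt => [i|i|].
  - exact: poly_lsub.
  - have [q qE] := @polyfun_coord R _ (rshift m (rshift n (lshift 1 i))).
    by exists q => x; rewrite !mxE -qE.
  - have [q qE] := @polyfun_coord R _ (rshift m (rshift n (rshift m (0 : 'I_1)))).
    by exists q => x; rewrite !mxE -qE.
pose A := [set z | D z /\ ~ P (row_mx (f (rsubmx z)) (c (lsubmx z 0 0)))].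
have dA : definable S A := definable_fun_preimage dF (definableC dP).
have AE t y : t \in `]0, e[ -> X y ->
    A (row_mx t%:M y) <-> ~ (`|f y - f (g t)| < eps t).
  move=> te Xy; rewrite /A /D /P /= /c !(row_mxKl, row_mxKr) !mxE !mulr1n.
  by split=> [[]|].
pose p t : 'rV[R]_(1 + n) := row_mx t%:M (g t).
exists (fun t => tdist A (p t)).
  apply: is_scurve_fun (is_curve_row is_scurve_id gX) => [|z _].
    by apply: (definable_ext (definable_tdist dA)) => z /=; split=> // -[].
  by apply: cvg_within_filter; exact: (tdist_cvg dA).
apply: filterS (near0 e0) => t te.
have [Xgt /= et0] := cZ t te.
rewrite /c row_mxKl in Xgt; rewrite /c !row_mxKr mxE mulr1n in et0.
have [[_ tA] tmax] := tdistP dA (p t).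
split; last first.
  (* If the bound failed at [y], then [(t, y)] would lie in [A], at distance [|y - g t|] from
     [(t, g t)], which is below the distance to [A]. *)
  move=> y Xy yt; apply: contrapT => /(AE t y te Xy)/tA.
  rewrite /p opp_row_mx add_row_mx subrr; apply/negP; rewrite -ltNge.
  by apply/row_mx_norm_lt; split=> //; rewrite normr0 (le_lt_trans _ yt).
(* Positivity of the distance. For [(s, y)] close to [(t, g t)], both [f y] and [f (g s)] are within
   [eps t / 4] of [f (g t)], while [eps s > 3/4 eps t]. So [|f y - f (g s)| < eps t / 2 < eps s],
   and [(s, y)] is not in [A]. *)
have et4 : 0 < eps t / 4 by rewrite divr_gt0.
have [r1 r10 H1] := within_continuous_local fc Xgt et4.
have [r2 r20 H2] := is_curve_local cc te et4.
(* The 1 accounts for the truncation of [tdist]. *)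
pose r := Num.min 1 (Num.min r1 r2).
have r0 : 0 < r by rewrite !lt_min ltr01 r10 r20.
apply: lt_le_trans r0 _; apply: tmax; split; first by rewrite ge_min lexx.
move=> a Aa; rewrite leNgt; apply/negP.
have [[ae Xa] _] := Aa; move: Aa.
rewrite -(hsubmxK a) (_ : lsubmx a = (lsubmx a 0 0)%:M); last exact/eq_scalar11.
move: (lsubmx a 0 0) (rsubmx a) ae Xa => s y se Xy /(AE s y se Xy) sy.
rewrite /p opp_row_mx add_row_mx => /row_mx_norm_lt[].
rewrite -raddfB => /scalar_norm_lt st yt.
move: st yt; rewrite !lt_min => /and3P[_ _ /H2 st] /and3P[_ /(H1 _ Xy) yt _].
apply: sy; move: st; rewrite /c !opp_row_mx !add_row_mx -raddfB.
move=> /row_mx_norm_lt[_ /row_mx_norm_lt[st /scalar_norm_lt]].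
rewrite ltr_norml => /andP[se1 se2].
have : `|f y - f (g s)| <= `|f y - f (g t)| + `|f (g s) - f (g t)|.
  by rewrite (distrC (f (g s))) ler_distD.
by lra.
Qed.

End modulus.

(** * Strict inequalities and norms of germs, read at small parameters *)

Section germs.
Context {R : rcfType} (S : ominimal R).
Local Notation K := (germ_field S).

(** The order only gives [<=] near 0 and [x != y]. By o-minimality [y - x] is either positive near 0
    or nonpositive near 0, and the latter would give [y <= x]. *)
Lemma germ_gtP (x y : K) :
  x < y <-> \forall t \near 0^'+, germ_val x t < germ_val y t.
Proof.
split=> [xy|H]; last first.
  rewrite lt_neqAle; apply/andP; split.
    apply/eqP => xy; have : \forall t \near (0 : R)^'+, False.
      by apply: filterS H => t; rewrite xy ltxx.
    by move/filter_ex => [].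
  by apply/germ_geP; apply: filterS H => t /ltW.
have E : \forall t \near 0^'+, germ_val (y - x) t = germ_val y t - germ_val x t.
  by apply: filterS2 (germ_valD y (- x)) (germ_valN x) => t -> ->.
have [H|H] := germ_dichotomy (y - x) (definable_gt0 S (polyfun_coord (0 : 'I_1))).
  by apply: filterS2 E H => t /= + ; rewrite mxE mulr1n => ->; rewrite subr_gt0.
suff : y <= x by rewrite leNgt xy.
apply/germ_geP; apply: filterS2 E H => t /=; rewrite mxE mulr1n => -> /negP.
by rewrite subr_gt0 -leNgt.
Qed.

Lemma germ_valB (x y : K) :
  \forall t \near 0^'+, germ_val (x - y) t = germ_val x t - germ_val y t.
Proof. by apply: filterS2 (germ_valD x (- y)) (germ_valN y) => t -> ->. Qed.

Lemma germ_val_norm (x : K) :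
  \forall t \near 0^'+, germ_val `|x| t = `|germ_val x t|.
Proof.
case: (lerP 0 x) => x0.
  rewrite ger0_norm //; have /germ_ge0P := x0.
  by apply: filterS => t /ger0_norm ->.
have := (germ_le0P x).1 (ltW x0); rewrite ltr0_norm //.
by apply: filterS2 (germ_valN x) => t -> /ler0_norm ->.
Qed.

Lemma germ_dist_ltP (x y d : K) :
  `|x - y| < d <->
  \forall t \near 0^'+, `|germ_val x t - germ_val y t| < germ_val d t.
Proof.
split=> [/germ_gtP H|H]; [|apply/germ_gtP];
by apply: filterS3 (germ_val_norm (x - y)) (germ_valB x y) H => t -> ->.
Qed.

Lemma tilde_incl_val n (X : set 'rV[R]_n) (x : tilde S X) i :
  \forall t \near 0^'+, germ_val ((tilde_incl x : 'rV[K]_n) 0 i) t = repr x t 0 i.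
Proof. by rewrite mxE; exact: germ_valE. Qed.

Lemma enorm_coord n (x : euclidean S n) i : `|(x : 'rV[K]_n) 0 i| <= enorm x.
Proof.
rewrite -ler_sqr ?nnegrE ?normr_ge0 ?enorm_ge0 // sqr_germ_sqrt ?enorm_sum_ge0 //.
rewrite real_normK ?num_real // (bigD1 i) //= lerDl.
by apply: sumr_ge0 => j _; exact: sqr_ge0.
Qed.

(** With [enorm_coord], this compares the Euclidean norm with the maximum norm. The squares sum to
    at most [n d^2 < (n+1)^2 d^2]; the factor [n+1] keeps this strict even for [n = 0]. *)
Lemma enorm_lt n (x : euclidean S n) (d : K) : 0 < d ->
  (forall i, `|(x : 'rV[K]_n) 0 i| < d) -> enorm x < n.+1%:R * d.
Proof.
move=> d0 xd; have nd0 : 0 < n.+1%:R * d by rewrite mulr_gt0 // ltr0Sn.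
rewrite -ltr_sqr ?nnegrE ?enorm_ge0 ?(ltW nd0) // sqr_germ_sqrt ?enorm_sum_ge0 //.
apply: (@le_lt_trans _ _ (\sum_(i < n) d ^+ 2)).
  apply: ler_sum => i _; rewrite -real_normK ?num_real //.
  by rewrite ler_sqr ?nnegrE ?(ltW (xd i)) // ltW.
rewrite sumr_const card_ord exprMn -[d ^+ 2 *+ n]mulr_natl ltr_pM2r ?exprn_gt0 //.
by rewrite -natrX ltr_nat -[X in (X <= _)%N]expn1 leq_pexp2l.
Qed.

End germs.

(** * Continuity of the induced map on germs *)

Section tilde_modulus.
Context {R : rcfType} (S : ominimal R) (n m : nat).
Context (X : set 'rV[R]_n) (Y : set 'rV[R]_m) (f : 'rV[R]_n -> 'rV[R]_m).
Hypotheses (X_def : definable S X) (f_XY : set_fun X Y f)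
  (f_def : definable_fun S X f) (f_cont : {within X, continuous f}).
Local Notation tf := (tilde_map f_XY f_def f_cont).

Lemma tilde_map_val (x : tilde S X) :
  \forall t \near 0^'+, repr (tf x) t = f (repr x t).
Proof. exact: repr_germ. Qed.

(** The germ of the function from [modulus_curve], taken along a representative of [x], is the
    radius: inequalities between germs become inequalities for all small [t], to which the pointwise
    bound applies. *)
Lemma tilde_modulus (x : tilde S X) (r : germ_field S) : 0 < r ->
  exists2 d : germ_field S, 0 < d & forall y : tilde S X,
    enorm (tilde_incl y - tilde_incl x) < d ->
    enorm (tilde_incl (tf y) - tilde_incl (tf x)) < r.
Proof.
(* The divisor compensates the constant of [enorm_lt]. *)
move=> r0; pose q := r / m.+1%:R.
have q0 : 0 < q by rewrite divr_gt0 // ltr0Sn.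
have q0' : \forall t \near 0^'+, 0 < germ_val q t.
  by move/germ_gtP : q0; apply: filterS2 (germ_val0 S) => t ->.
have [h hs hP] := modulus_curve f_def f_cont X_def
  (curveP (repr x)) (germ_valP q) q0'.
have h0 : \forall t \near 0^'+, 0 < h t by apply: filterS hP => t [].
exists (germ hs).
  apply/germ_gtP; apply: filterS3 (germ_val0 S) (germ_valE hs) h0.
  by move=> t -> ->.
move=> y yx; rewrite -[r](divfK (x := m.+1%:R)) ?pnatr_eq0 // mulrC.
have Yy : \forall t \near 0^'+, X (repr y t).
  have [e e0 [yX _ _]] := curveP (repr y).
  by apply: filterS (near0 e0) => t; exact: yX.
have yxh : \forall t \near 0^'+, forall i,
    `|repr y t 0 i - repr x t 0 i| < h t.
  apply: filter_forall => i; have := le_lt_trans (enorm_coord _ i) yx.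
  rewrite [(_ - _ : 'rV_n) 0 i]mxE [(- _ : 'rV_n) 0 i]mxE => /germ_dist_ltP H.
  near=> t; have := near H t; rewrite (near (germ_valE hs) t) //.
  by rewrite (near (tilde_incl_val y i) t) // (near (tilde_incl_val x i) t) //; exact.
have fyx : \forall t \near 0^'+,
    `|repr (tf y) t - repr (tf x) t| < germ_val q t.
  near=> t; rewrite (near (tilde_map_val y) t) // (near (tilde_map_val x) t) //.
  have [ht0 ht] : 0 < h t /\ forall z, X z -> `|z - repr x t| < h t ->
    `|f z - f (repr x t)| < germ_val q t by near: t.
  apply: ht; first by near: t.
  by apply/rV_norm_ltP; split=> // i; rewrite !mxE; move: i; near: t.
apply: enorm_lt => // j.
rewrite [(_ - _ : 'rV_m) 0 j]mxE [(- _ : 'rV_m) 0 j]mxE; apply/germ_dist_ltP.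
near=> t; rewrite (near (tilde_incl_val (tf y) j) t) //.
rewrite (near (tilde_incl_val (tf x) j) t) //.
have /rV_norm_ltP[_ /(_ j)] : `|repr (tf y) t - repr (tf x) t| < germ_val q t.
  by near: t.
by rewrite !mxE.
Unshelve. all: by end_near. Qed.

End tilde_modulus.

Theorem corollary3p11 (R : rcfType) (S : ominimal R) (n m : nat)
    (X : set 'rV[R]_n) (Y : set 'rV[R]_m) (f : 'rV[R]_n -> 'rV[R]_m)
    (X_def : definable S X) (Y_def : definable S Y)
    (f_XY : set_fun X Y f) (f_def : definable_fun S X f)
    (f_cont : {within X, continuous f}) :
  continuous (tilde_map f_XY f_def f_cont : tilde S X -> tilde S Y).
Proof.
(* The target has the initial topology of [tilde_incl], so continuity is tested after composing with
   it; open sets of the Euclidean space then reduce the claim to balls. *)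
apply: continuous_comp_initial => x A /=.
rewrite nbhs_simpl /= nbhsE => -[U [oU Ux] UA].
have [r r0 rU] := (euclidean_openP U).1 oU _ Ux.
have [d d0 dP] := tilde_modulus X_def f_XY f_def f_cont x r0.
have xd : nbhs (tilde_incl x) (eball (tilde_incl x) d).
  apply: open_nbhs_nbhs; split; first exact: eball_open.
  by rewrite /eball /= subrr enorm0.
have := @initial_continuous _ _ (@tilde_incl R S n X) x _ xd.
by apply: (@filterS _ (nbhs x)) => y /= /dP yr; exact/UA/rU.
Qed.
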